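(* Let $I=[0,1]$ or $I=[0,\infty)$ and let $X$ be a Banach function space on $I$ such that the abstract Copson function space $C^*X$ is nontrivial (i.e. $C^*X\ne\{0\}$). Then $C^*X$ contains an order asymptotically isometric copy of $\ell^1$.
   Context: $L^0(I)$ is the space of (a.e. equivalence classes of) real-valued Lebesgue measurable functions on $I$. A Banach function space $X$ on $I$ is a Banach space that is a linear subspace of $L^0(I)$ with the ideal property: $|f|\le|g|$ a.e., $f\in L^0(I)$, $g\in X$ imply $f\in X$ and $\|f\|_X\le\|g\|_X$; by convention $X$ is also assumed to contain a function positive a.e. on $I$ (this is not assumed for the derived space $C^*X$). Copson operator: $C^*f(x)=\int_{I\cap[x,\infty)}\frac{f(t)}{t}\,dt$ for $x\in I$. $C^*X=\{f\in L^0(I): C^*|f|\in X\}$ with norm $\|f\|_{C^*X}=\|C^*|f|\|_X$. A space $E\subset L^0(I)$ with the ideal property and complete norm contains an order asymptotically isometric copy of $\ell^1$ if there are a sequence $(f_n)\subset E$ with pairwise disjoint supports and a sequence $(\varepsilon_n)\subset(0,1)$ with $\varepsilon_n\to0$ such that $\sum_{n=1}^\infty(1-\varepsilon_n)|\alpha_n|\le\left\|\sum_{n=1}^\infty\alpha_nf_n\right\|_E\le\sum_{n=1}^\infty|\alpha_n|$ for each $(\alpha_n)\in\ell^1$. *)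

(* Defs.v *)
From HB Require Import structures.
From mathcomp Require Import all_boot all_order all_algebra.
From mathcomp Require Import all_classical all_reals all_analysis.

Set Implicit Arguments.
Unset Strict Implicit.
Unset Printing Implicit Defensive.
Import Order.TTheory GRing.Theory Num.Theory.
Import numFieldTopology.Exports numFieldNormedType.Exports.

Local Open Scope classical_set_scope.
Local Open Scope ring_scope.

(* R with the sigma-algebra of Lebesgue (not just Borel) measurable sets, i.e.
   the domain of [completed_lebesgue_measure]. *)
Notation lebesgue_type R := (caratheodory_type (wlength (@idfun R))^*%mu).

(* Elements of L^0(I) are given by representatives R -> R whose values outside
   I are irrelevant; equality in L^0(I) is a.e. equality on I. *)
Definition L0 (R : realType) (I : set R) : set (R -> R) :=
  [set f | measurable_fun (I : set (lebesgue_type R))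
                          (f : lebesgue_type R -> R)].

Definition ae_on (R : realType) (I : set R) (P : R -> Prop) : Prop :=
  \forall x \ae (@completed_lebesgue_measure R), I x -> P x.

(* The norm is only meaningful on the carrier. *)
Record function_space (R : realType) := FunctionSpace {
  carrier :> (R -> R) -> Prop;
  fnorm : (R -> R) -> R
}.

(* Invariance of the carrier and of the norm under a.e. equality on I is a
   consequence of [ideal_property]. *)
Definition linear_subspace (R : realType) (I : set R) (X : function_space R) :=
  [/\ forall f, X f -> L0 I f,
      X (cst 0),
      forall f g, X f -> X g -> X (f \+ g) &
      forall (a : R) f, X f -> X (fun x => a * f x)].

Definition is_norm (R : realType) (I : set R) (X : function_space R) :=
  [/\ forall f, X f -> 0 <= fnorm X f,
      forall f, X f -> (fnorm X f = 0 <-> ae_on I (fun x => f x = 0)),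
      forall (a : R) f, X f -> fnorm X (fun x => a * f x) = `|a| * fnorm X f &
      forall f g, X f -> X g -> fnorm X (f \+ g) <= fnorm X f + fnorm X g].

Definition norm_cvg (R : realType) (X : function_space R)
    (u : (R -> R)^nat) (f : R -> R) :=
  fnorm X (u n \- f) @[n --> \oo] --> (0 : R).

Definition norm_complete (R : realType) (X : function_space R) :=
  forall u : (R -> R)^nat, (forall n, X (u n)) ->
    (forall e : R, 0 < e -> exists N, forall m n, (N <= m)%N -> (N <= n)%N ->
      fnorm X (u m \- u n) < e) ->
    exists2 f, X f & norm_cvg X u f.

Definition ideal_property (R : realType) (I : set R) (X : function_space R) :=
  forall f g, L0 I f -> X g -> ae_on I (fun x => `|f x| <= `|g x|) ->
    X f /\ fnorm X f <= fnorm X g.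

Definition banach_function_space (R : realType) (I : set R)
    (X : function_space R) :=
  [/\ linear_subspace I X, is_norm I X, norm_complete X, ideal_property I X &
      exists2 w, X w & ae_on I (fun x => 0 < w x)].

Definition copson (R : realType) (I : set R) (f : R -> R) (x : R) : \bar R :=
  (\int[@completed_lebesgue_measure R]_(t in I `&` `[x, +oo[) (f t / t)%:E)%E.

(* C^*|f| as a real-valued function; [fine] sends +oo to 0, which is harmless
   only when C^*|f| is finite a.e. on I, as [copson_space] requires. *)
Definition copson_abs (R : realType) (I : set R) (f : R -> R) : R -> R :=
  fun x => fine (copson I (fun t => `|f t|) x).

Definition copson_space (R : realType) (I : set R) (X : function_space R) :
    function_space R :=
  {| carrier := fun f => [/\ L0 I f,
       ae_on I (fun x => copson I (fun t => `|f t|) x \is a fin_num) &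
       X (copson_abs I f)];
     fnorm f := fnorm X (copson_abs I f) |}.

Definition nontrivial (R : realType) (I : set R) (E : function_space R) :=
  exists2 f, E f & ~ ae_on I (fun x => f x = 0).

Definition disjoint_supports (R : realType) (I : set R) (f g : R -> R) :=
  ae_on I (fun x => f x = 0 \/ g x = 0).

(* The series of the alpha_n f_n converges in the norm of E, and g is its sum,
   which is unique up to a.e. equality. *)
Definition order_asymptotically_isometric_l1_copy (R : realType) (I : set R)
    (E : function_space R) :=
  exists (f : (R -> R)^nat) (eps : R^nat),
    [/\ forall n, E (f n),
        forall m n, m <> n -> disjoint_supports I (f m) (f n),
        forall n, 0 < eps n < 1,
        eps n @[n --> \oo] --> (0 : R) &
        forall alpha : R^nat, cvgn (series (fun n => `|alpha n|)) ->
          exists g : R -> R,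
            [/\ E g,
                norm_cvg E (fun N x => \sum_(0 <= n < N) alpha n * f n x) g,
                limn (series (fun n => (1 - eps n) * `|alpha n|)) <= fnorm E g &
                fnorm E g <= limn (series (fun n => `|alpha n|))]].

(* Main.v *)
Require Import Defs.
From mathcomp Require Import all_boot all_order all_algebra.
From mathcomp Require Import all_classical all_reals all_analysis.
From mathcomp Require Import measurable_realfun lra.
Import Order.TTheory GRing.Theory Num.Theory.
Import numFieldTopology.Exports numFieldNormedType.Exports.
Local Open Scope classical_set_scope.
Local Open Scope ring_scope.

(** Write $\chi_{[0,x]}$ for the indicator function of $[0,x]$ and
    $\varphi(x)=\|\chi_{[0,x]}\|_X$.

    The Copson transform $C^*|f|$ is nonincreasing, so if $C^*X$ contains an
    $f\neq 0$, then $C^*|f|$ dominates a positive multiple of $\chi_{[0,r]}$ for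
    some $r>0$; by the ideal property $\varphi$ is finite, positive and
    nondecreasing on $(0,r]$ ([copson_space_nontrivial_indic]).  Such a function
    is right-continuous at some point $s\in(0,r)$, which yields a strictly
    decreasing sequence $b_n>s$ with $\varphi(b_n)\to\varphi(s)$
    ([nondecreasing_right_continuity_point]).

    Let $f_n$ be supported on $[b_{n+1},b_n)$ with $f_n(t)/t$ constant there and
    of integral $w_n=1/\varphi(b_n)$.  Then $C^*f_n$ equals $w_n$ on
    $[0,b_{n+1}]$ and vanishes to the right of $b_n$, whence
    $w_n\chi_{[0,s]}\le C^*f_n\le w_n\chi_{[0,b_n]}$ on $I$.  As the $f_n$ are
    disjoint, $C^*|\sum_n\alpha_nf_n|=\sum_n|\alpha_n|C^*f_n$
    ([copson_blocksum]), so that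
    $$\sum_n|\alpha_n|\frac{\varphi(s)}{\varphi(b_n)}
      \le\Big\|\sum_n\alpha_nf_n\Big\|_{C^*X}\le\sum_n|\alpha_n|.$$
    The quotients $\varphi(s)/\varphi(b_n)$ tend to $1$, which is the asymptotic
    isometry.

    The upper bound for infinite sums ([fnorm_series_le]) rests on a common
    majorant: all $w_n\chi_{[0,b_n]}$ lie below the single function
    $\chi_{[0,b_0]}/\varphi(s)\in X$, so the tail of the series is pointwise at
    most $\sum_{n\ge N}|\alpha_n|$ times that function, and the ideal property
    controls its norm.  Applied to the tail $\sum_{n\ge N}\alpha_nf_n$ itself,
    the same bound gives the convergence of the series in the norm of $C^*X$. *)

(** * Lebesgue measurability and almost everywhere statements *)

Local Notation mu R := (@completed_lebesgue_measure R).

Lemma borel_lebesgue_measurable {R : realType} {A : set R} :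
  measurable A -> measurable (A : set (lebesgue_type R)).
Proof. exact: sub_caratheodory. Qed.

Lemma borel_measurable_fun_lebesgue {R : realType} {D : set R} {f : R -> R} :
  measurable D -> measurable_fun D f ->
  measurable_fun (D : set (lebesgue_type R)) (f : lebesgue_type R -> R).
Proof.
by move=> mD mf _ B mB; apply: borel_lebesgue_measurable; exact: mf.
Qed.

Lemma completed_lebesgue_measure_itv {R : realType} (i : interval R) :
  mu R [set` i] = (if i.1 < i.2 then (i.2 : \bar R) - i.1 else 0)%E.
Proof. exact: (lebesgue_measure_itv i). Qed.

(** Stated for the filter as it occurs in [ae_on], so that the filter lemmas can
    be given this instance explicitly. *)
Lemma ae_filter (R : realType) :
  Filter (nbhs (almost_everywhere (mu R))).
Proof. exact: ae_filter_ringOfSetsType. Qed.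

Lemma ae_onW {R : realType} (I : set R) (P : R -> Prop) :
  (forall x, I x -> P x) -> ae_on I P.
Proof. by move=> h; apply: (@filterE _ _ (ae_filter R)) => x; exact: h. Qed.

Lemma ae_onS {R : realType} (I : set R) (P Q : R -> Prop) :
  (forall x, I x -> P x -> Q x) -> ae_on I P -> ae_on I Q.
Proof.
move=> PQ; rewrite /ae_on; have FF := ae_filter R.
by apply: filterS => x h Ix; exact: (PQ _ Ix (h Ix)).
Qed.

(** This is how the positive measure of $[0,b]$ enters: an a.e. property can
    be tested at some point arbitrarily close to the origin. *)
Lemma ae_on_itv0_ex {R : realType} (I : set R) (P : R -> Prop) (b : R) :
  0 < b -> `[0, b] `<=` I -> ae_on I P -> exists2 x, 0 <= x <= b & P x.
Proof.
move=> b0 bI [N [mN N0 PN]]; apply: contrapT => nex.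
have sub : `[0, b]%classic `<=` N.
  move=> x xb; apply: PN => /= h; apply: nex; exists x; last exact/h/bI.
  by move: xb; rewrite /= in_itv.
have : (mu R `[0%R, b]%classic <= mu R N)%E.
  by apply: le_measure; rewrite ?inE//; apply: borel_lebesgue_measurable.
rewrite N0 completed_lebesgue_measure_itv/= lte_fin b0 -EFinB lee_fin subr0.
by rewrite leNgt b0.
Qed.

Lemma ae_neq0 (R : realType) : {ae mu R, forall t : R, t <> 0}.
Proof.
exists [set 0 : R]; split.
- by apply: borel_lebesgue_measurable; exact: measurable_set1.
- by rewrite -set_itv1 completed_lebesgue_measure_itv/= ltxx.
- by move=> t/= /contrapT.
Qed.

(** The kernel $1/t$ agrees on $[x,\infty)$ with the function $1/\max(x,t)$,
    which is monotone on the whole line and therefore measurable. *)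
Lemma L0_abs_div {R : realType} (I : set R) (f : R -> R) (x : R) :
  measurable I -> 0 < x -> L0 I f ->
  measurable_fun (I `&` `[x, +oo[ : set (lebesgue_type R))
    (fun t => (`|f t| / t)%:E).
Proof.
move=> mI x0 If; apply/measurable_EFinP.
have mD : measurable (I `&` `[x, +oo[) by exact: measurableI.
apply: (@eq_measurable_fun _ _ (lebesgue_type R) R _
    (fun t => `|f t| * (Num.max x t)^-1)).
  move=> t; rewrite inE/= in_itv/= andbT => -[_ xt].
  by rewrite (max_idPr xt).
apply: measurable_funM.
  apply: measurableT_comp => //.
  by apply: measurable_funS If => //; exact: borel_lebesgue_measurable.
apply: (@borel_measurable_fun_lebesgue R _ (fun t => (Num.max x t)^-1)) => //.
apply: nonincreasing_measurable => // s t st.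
rewrite lef_pV2 ?posrE ?lt_max ?x0//.
by rewrite ge_max le_max lexx le_max st orbT.
Qed.

(** * The Copson transform of a function *)

Lemma copson_ge0 {R : realType} (I : set R) (f : R -> R) (x : R) :
  I `<=` [set t | 0 <= t] -> (0 <= copson I (fun t => `|f t|%R) x)%E.
Proof.
by move=> I0; apply: integral_ge0 => t [/I0/= t0 _]; rewrite lee_fin divr_ge0.
Qed.

Lemma copson_nincr {R : realType} (I : set R) (f : R -> R) (x y : R) :
  measurable I -> I `<=` [set t | 0 <= t] -> L0 I f -> 0 < x -> x <= y ->
  (copson I (fun t => `|f t|%R) y <= copson I (fun t => `|f t|%R) x)%E.
Proof.
move=> mI I0 If x0 xy; apply: ge0_subset_integral.
- by apply: borel_lebesgue_measurable; exact: measurableI.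
- by apply: borel_lebesgue_measurable; exact: measurableI.
- exact: L0_abs_div.
- by move=> t [/I0/= t0 _]; rewrite lee_fin divr_ge0.
- apply: setIS => t; rewrite /= !in_itv/= !andbT; exact: le_trans.
Qed.

(** A vanishing integral of $|f(t)|/t$ over $I\cap[1/(n+1),\infty)$ forces
    $f=0$ a.e. there, and these sets exhaust $I$ up to the null set $\{0\}$. *)
Lemma copson_eq0_ae {R : realType} (I : set R) (f : R -> R) :
  measurable I -> I `<=` [set t | 0 <= t] -> L0 I f ->
  (forall n, copson I (fun t => `|f t|%R) n.+1%:R^-1 = 0%E) ->
  ae_on I (fun x => f x = 0).
Proof.
move=> mI I0 If f0.
have aen n : {ae mu R, forall t, (I `&` `[n.+1%:R^-1, +oo[) t -> f t = 0}.
  have /ae_eq_integral_abs : measurable_fun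
     (I `&` `[n.+1%:R^-1, +oo[ : set (lebesgue_type R))
     (fun t => (`|f t| / t)%:E).
    by apply: L0_abs_div; rewrite ?invr_gt0.
  have mD : measurable
      (I `&` `[n.+1%:R^-1, +oo[ : set (lebesgue_type R)).
    by apply: borel_lebesgue_measurable; exact: measurableI.
  move=> /(_ (mu R) mD)[+ _].
  have -> : (\int[mu R]_(t in I `&` `[(n.+1%:R^-1)%R, +oo[) `|(`|f t| / t)%:E| = 0)%E.
    rewrite -[RHS](f0 n); apply: eq_integral => t; rewrite inE => -[/I0 t0 _].
    by rewrite gee0_abs// lee_fin divr_ge0.
  move=> /(_ erefl); apply: filterS => t h Dt.
  have := h Dt; move=> /= -[] /eqP; rewrite mulf_eq0 normr_eq0 => /orP[/eqP//|].
  case: Dt => _; rewrite /= in_itv/= andbT invr_eq0 => nt /eqP t0.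
  by move: nt; rewrite t0 leNgt invr_gt0 ltr0n.
have FF := ae_filter R.
apply: filterS2 (ae_neq0 R) (ae_foralln aen) => t t0 h It.
have tp : 0 < t by rewrite lt_neqAle eq_sym; apply/andP; split; [exact/eqP|exact: I0].
have [n nt] : exists n : nat, n.+1%:R^-1 <= t.
  exists (Num.truncn t^-1); rewrite invf_ple ?posrE//.
  by rewrite ltW// truncnS_gt.
by apply: (h n); split => //=; rewrite in_itv/= nt.
Qed.

(** * Series of functions supported on disjoint blocks *)

Lemma cvg_series_single {R : realType} (u : R^nat) (m : nat) :
  (forall n, n <> m -> u n = 0) -> series u @ \oo --> u m.
Proof.
move=> u0; apply: cvg_near_cst; near=> n.
have mn : (m < n)%N by near: n; exists m.+1.
rewrite /series/= (bigD1_seq m) ?mem_index_iota ?iota_uniq//=.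
by rewrite big1 ?addr0// => i /eqP/u0.
Unshelve. all: by end_near. Qed.

Lemma EFin_lim_series {R : realType} (u : R^nat) : cvgn (series u) ->
  (\sum_(n <oo) (u n)%:E = (limn (series u))%:E)%E.
Proof.
move=> cu; rewrite -EFin_lim//; congr (limn _); apply/funext => n /=.
by rewrite sumEFin.
Qed.

(** The factor $t$ compensates the kernel of the Copson operator: the integrand
    $|f_n(t)|/t$ is $k_n$ times the indicator function of $J_n$ as soon as
    $J_n\subset(0,\infty)$ and $k_n\ge0$. *)
Definition block {R : realType} (k : R^nat) (J : (set R)^nat) (n : nat) (t : R) : R :=
  k n * (t * \1_(J n) t).

Definition blocksum {R : realType} (k : R^nat) (J : (set R)^nat) (alpha : R^nat) (t : R) : R :=
  limn (series (fun n => alpha n * block k J n t)).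

Section blocks.
Context {R : realType} (I : set R) (k : R^nat) (J : (set R)^nat).
Hypothesis mI : measurable I.
Hypotheses (k0 : forall n, 0 <= k n) (mJ : forall n, measurable (J n)).
Hypotheses (tJ : trivIset setT J) (J0 : forall n t, J n t -> 0 < t).

Lemma trivIset_indic_single (t : R) :
  exists m, forall n, n <> m -> \1_(J n) t = 0 :> R.
Proof.
have [[m Jm]|nJ] := pselect (exists m, J m t).
  exists m => n nm; rewrite indicE memNset// => Jn; apply: nm.
  by apply: (tJ n m Logic.I Logic.I); exists t.
by exists 0%N => n _; rewrite indicE memNset// => Jn; apply: nJ; exists n.
Qed.

Lemma cvg_blocksum (alpha : R^nat) (t : R) :
  series (fun n => alpha n * block k J n t) @ \oo --> blocksum k J alpha t.
Proof.
have [m m0] := trivIset_indic_single t.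
apply/cvg_ex; exists (alpha m * block k J m t).
apply: (@cvg_series_single R (fun n => alpha n * block k J n t)) => n nm.
by rewrite /block m0// !mulr0.
Qed.

(** Disjointness is what moves the absolute value inside the sum: at each $t$
    at most one term is nonzero. *)
Lemma abs_blocksum_div (alpha : R^nat) (t : R) :
  ((`|blocksum k J alpha t| / t)%:E =
   \sum_(n <oo) (`|alpha n| * k n * \1_(J n) t)%:E)%E.
Proof.
have [m m0] := trivIset_indic_single t.
have cu := @cvg_series_single R (fun n => `|alpha n| * k n * \1_(J n) t) m _.
rewrite EFin_lim_series; last first.
  by apply/cvg_ex; eexists; apply: cu => n nm; rewrite m0// mulr0.
rewrite (cvg_lim _ (cu _))//; last by move=> n nm; rewrite m0// mulr0.
congr EFin; rewrite /blocksum.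
have /cvg_lim -> // : series (fun n => alpha n * block k J n t) @ \oo -->
    alpha m * block k J m t.
  apply: (@cvg_series_single R (fun n => alpha n * block k J n t)) => n nm.
  by rewrite /block m0// !mulr0.
have [Jt|Jt] := pselect (J m t); last first.
  by rewrite /block indicE memNset// !mulr0 normr0 mul0r.
have t0 := J0 _ _ Jt.
rewrite /block indicE mem_set// !mulr1 !normrM (ger0_norm (k0 m)) (gtr0_norm t0).
by rewrite -!mulrA divff ?mulr1// gt_eqF.
Qed.

(** Monotone convergence turns the disjoint sum under the integral into a sum
    of the masses of the blocks that lie to the right of $x$. *)
Lemma copson_blocksum (alpha : R^nat) (x : R) :
  (copson I (fun t => `|blocksum k J alpha t|%R) x =
   \sum_(n <oo) (`|alpha n| * k n)%:E * mu R (J n `&` (I `&` `[x, +oo[)))%E.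
Proof.
have mD : measurable (I `&` `[x, +oo[ : set (lebesgue_type R)).
  by apply: borel_lebesgue_measurable; exact: measurableI.
have mJl n : measurable (J n : set (lebesgue_type R)).
  exact: borel_lebesgue_measurable.
rewrite /copson; under eq_integral do rewrite abs_blocksum_div.
have mI_ n : @measurable_fun _ _ (lebesgue_type R) R (I `&` `[x, +oo[) (\1_(J n)).
  exact: (@measurable_indic _ (lebesgue_type R)).
have mc n : @measurable_fun _ _ (lebesgue_type R) (\bar R) (I `&` `[x, +oo[)
    (fun t => (`|alpha n| * k n * \1_(J n) t)%:E).
  by apply/measurable_EFinP; exact: measurable_funM.
have c0 n t : (I `&` `[x, +oo[) t -> (0 <= (`|alpha n| * k n * \1_(J n) t)%:E)%E.
  by move=> _; rewrite lee_fin !mulr_ge0.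
rewrite (integral_nneseries (mu R) mD mc c0).
apply: eq_eseriesr => n _.
under eq_integral do rewrite EFinM.
have m1 := (measurable_EFinP _ _).2 (mI_ n).
have i0 t : (I `&` `[x, +oo[) t -> (0 <= (EFin \o (\1_(J n) : R -> R)) t)%E.
  by move=> _; rewrite lee_fin.
rewrite (ge0_integralZl_EFin (mu R) mD i0 m1); first by rewrite integral_indic.
by rewrite mulr_ge0.
Qed.

Lemma L0_blocksum (alpha : R^nat) : L0 I (blocksum k J alpha).
Proof.
apply: borel_measurable_fun_lebesgue => //.
apply: (@measurable_fun_cvg _ _ _ _
    (fun N t => series (fun n => alpha n * block k J n t) N)).
  move=> N; apply: measurable_sum => n.
  apply: measurable_funM; first exact: measurable_cst.
  apply: (@measurable_funM _ _ _ _ (cst (k n))); first exact: measurable_cst.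
  apply: (@measurable_funM _ _ _ _ id); first exact: measurable_id.
  exact: measurable_indic.
by move=> t _; exact: cvg_blocksum.
Qed.

End blocks.

(** * Norm of a pointwise series in a function space *)

Lemma fnorm_cst0 {R : realType} (I : set R) (X : function_space R) :
  linear_subspace I X -> is_norm I X -> fnorm X (cst 0) = 0.
Proof.
move=> [_ X0 _ _] [_ n0 _ _]; apply/(n0 _ X0).
exact: ae_onW.
Qed.

Lemma fnorm_sum_le {R : realType} (I : set R) (X : function_space R)
    (u : (R -> R)^nat) (c : R^nat) (N : nat) :
  linear_subspace I X -> is_norm I X ->
  (forall n, X (u n)) -> (forall n, fnorm X (u n) <= 1) ->
  X (fun x => \sum_(0 <= n < N) c n * u n x) /\
  fnorm X (fun x => \sum_(0 <= n < N) c n * u n x) <= \sum_(0 <= n < N) `|c n|.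
Proof.
move=> lX nX Xu u1; have [_ X0 XD XZ] := lX; have [_ _ nZ nD] := nX.
elim: N => [|N [XN IH]].
  under eq_fun do rewrite big_nil.
  by rewrite big_nil (fnorm_cst0 _ _ lX nX).
under eq_fun do rewrite big_nat_recr//=.
split; first exact: (XD _ _ XN (XZ _ _ (Xu N))).
rewrite big_nat_recr//=; apply: le_trans (nD _ _ XN (XZ _ _ (Xu N))) _.
by apply: lerD => //; rewrite nZ// ler_piMr.
Qed.

(** The common majorant $v$ controls remainders: $h$ is dominated by the $N$-th partial sum, of norm at most $\sum_{n<N}c_n$, plus
    $(\sum_{n\ge N}c_n)v$, whose norm tends to $0$ with $N$. *)
Lemma fnorm_series_le {R : realType} (I : set R) (X : function_space R)
    (u : (R -> R)^nat) (v h : R -> R) (c : R^nat) :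
  linear_subspace I X -> is_norm I X -> ideal_property I X ->
  (forall n, X (u n)) -> (forall n, fnorm X (u n) <= 1) -> X v ->
  (forall n x, I x -> 0 <= u n x <= v x) ->
  (forall n, 0 <= c n) -> cvgn (series c) ->
  L0 I h -> (forall x, I x -> `|h x| <= limn (series (fun n => c n * u n x))) ->
  X h /\ fnorm X h <= limn (series c).
Proof.
move=> lX nX iX Xu u1 Xv uv c0 cc L0h hle.
have [_ _ XD XZ] := lX; have [_ _ nZ nD] := nX.
pose r N := limn (series c) - series c N.
have sle N : series c N <= limn (series c).
  by apply: nondecreasing_cvgn_le => //; exact: nondecreasing_series.
have main N : X h /\ fnorm X h <= series c N + r N * fnorm X v.
  have [Xs ns] := @fnorm_sum_le R I X u c N lX nX Xu u1.
  have Xr := XZ (r N) v Xv.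
  have [|Xh nh] := iX h _ L0h (XD _ _ Xs Xr).
    apply: ae_onW => x Ix; apply: le_trans (ler_norm _).
    apply: le_trans (hle x Ix) _.
    apply: limr_le.
      apply: (@series_le_cvg _ _ (fun n => c n * v x)).
      - by move=> n; rewrite mulr_ge0//; have /andP[] := uv n x Ix.
      - move=> n; rewrite mulr_ge0//.
        by have /andP[+ /[dup] + _] := uv n x Ix; exact: le_trans.
      - by move=> n; rewrite ler_wpM2l//; have /andP[] := uv n x Ix.
      - have -> : (fun n => c n * v x) = v x *: c.
          by apply/funext => n /=; rewrite mulrC.
        exact: is_cvg_seriesZ.
    near=> M.
    have NM : (N <= M)%N by near: M; exists N.
    rewrite /series/= (big_cat_nat (leq0n N) NM)//= lerD2l /r.
    apply: (@le_trans _ _ (\sum_(N <= n < M) c n * v x)).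
      by apply: ler_sum => n _; rewrite ler_wpM2l//; have /andP[] := uv n x Ix.
    rewrite -mulr_suml ler_wpM2r//.
      by have /andP[+ /[dup] + _] := uv 0%N x Ix; exact: le_trans.
    rewrite lerBrDl; apply: le_trans (sle M).
    by rewrite [leRHS]/series/= (big_cat_nat (leq0n N) NM).
  split => //; apply: le_trans nh _; apply: le_trans (nD _ _ Xs Xr) _.
  apply: lerD.
    by apply: le_trans ns _; rewrite ler_sum// => n _; rewrite ger0_norm.
  by rewrite nZ// ger0_norm// /r subr_ge0.
split; first exact: (main 0%N).1.
have cr : series c N + r N * fnorm X v @[N --> \oo] --> limn (series c) + 0 * fnorm X v.
  apply: cvgD => //; apply: cvgMl; rewrite -(subrr (limn (series c))).
  by apply: cvgB => //; exact: cvg_cst.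
rewrite mul0r addr0 in cr.
rewrite -(cvg_lim _ cr)//; apply: limr_ge; first by apply/cvg_ex; eexists; exact: cr.
by apply: nearW => N; exact: (main N).2.
Unshelve. all: by end_near. Qed.

(** * A right-continuity point of a monotone function *)

(** Nested intervals: a strictly interior subinterval can always be chosen on
    which the increment of $\varphi$ is at most half of the previous one.  The
    point $s$ common to all of them works, with $b_n$ the right endpoints; the
    inclusions are strict so that $b_n$ strictly decreases and stays above
    $s$. *)
Lemma nondecreasing_right_continuity_point {R : realType} (phi : R -> R) (l r : R) :
  l < r -> {in `[l, r] &, {homo phi : x y / x <= y}} ->
  exists (s : R) (b : R^nat), [/\ l < s,
    forall n, s < b n, forall n, b n.+1 < b n, b 0%N <= r &
    phi (b n) @[n --> \oo] --> phi s].
Proof.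
move=> lr phi_nd.
have halve (p : R * R) : exists q : R * R,
    l <= p.1 -> p.1 < p.2 -> p.2 <= r ->
    [/\ p.1 < q.1, q.1 < q.2, q.2 < p.2 &
      phi q.2 - phi q.1 <= (phi p.2 - phi p.1) / 2].
  case: p => x y/=.
  (* The increments over $[x_1,x_2]$ and $[x_2,x_3]$ add up to at most that
     over $[x,y]$, so one of them is at most half of it. *)
  pose x1 := x + (y - x) / 4; pose x2 := x + (y - x) / 2.
  pose x3 := x + (y - x) * 3 / 4.
  have [h|h] := leP (phi x2 - phi x1) ((phi y - phi x) / 2).
    by exists (x1, x2) => lx xy yr; split => //=; rewrite /x1 /x2; lra.
  exists (x2, x3) => lx xy yr; split => //=; [rewrite /x2|rewrite /x2 /x3|rewrite /x3|]; try lra.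
  have h1 : phi x <= phi x1 by apply: phi_nd; rewrite ?in_itv/= /x1; lra.
  have h2 : phi x3 <= phi y by apply: phi_nd; rewrite ?in_itv/= /x3; lra.
  by move: h h1 h2; lra.
have [step stepP] := choice halve.
pose p n := iter n step (l, r).
have pP n : [/\ l <= (p n).1, (p n).1 < (p n).2 & (p n).2 <= r].
  elim: n => [|n [lx xy yr]]; first by split.
  have [h1 h2 h3 _] := stepP (p n) lx xy yr.
  by split => //; [exact: (le_trans lx (ltW h1))|exact: (le_trans (ltW h3) yr)].
have pS n : [/\ (p n).1 < (p n.+1).1, (p n.+1).2 < (p n).2 &
    phi (p n.+1).2 - phi (p n.+1).1 <= (phi (p n).2 - phi (p n).1) / 2].
  by have [lx xy yr] := pP n; have [] := stepP (p n) lx xy yr.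
have a_nd : nondecreasing_seq (fun n => (p n).1).
  by apply/nondecreasing_seqP => n; have [/ltW] := pS n.
have b_ni : nonincreasing_seq (fun n => (p n).2).
  by apply/nonincreasing_seqP => n; have [_ /ltW] := pS n.
have ab m n : (p m).1 <= (p n).2.
  have [_ h _] := pP (maxn m n).
  apply: (le_trans (a_nd _ _ (leq_maxl m n))).
  exact: (le_trans (ltW h) (b_ni _ _ (leq_maxr m n))).
pose A := range (fun n => (p n).1); pose s := sup A.
have hA : has_sup A.
  by split; [exists (p 0%N).1; exists 0%N|exists (p 0%N).2 => _ [n _ <-]].
have as_ n : (p n).1 <= s by apply: ub_le_sup; [exact: hA.2|exists n].
have sb_ n : s <= (p n).2 by apply: ge_sup; [exact: hA.1|move=> _ [m _ <-]].
have sb n : s < (p n).2.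
  by apply: le_lt_trans (sb_ n.+1) _; have [] := pS n.
exists s, (fun n => (p n).2); split => //.
- by apply: lt_le_trans (as_ 1%N); have [] := pS 0%N.
- by move=> n; have [] := pS n.
have gap n : phi (p n).2 - phi (p n).1 <= geometric (phi r - phi l) 2^-1 n.
  elim: n => [|n IH]; first by rewrite /geometric/= expr0 mulr1.
  have [_ _ h] := pS n; apply: le_trans h _.
  by rewrite /geometric/= exprSr mulrA ler_wpM2r.
have inI n : [/\ (p n).1 \in `[l, r], (p n).2 \in `[l, r] & s \in `[l, r]].
  have [lx xy yr] := pP n; have := as_ n; have := sb_ n.
  by rewrite !in_itv/= => h1 h2; split; apply/andP; split; lra.
apply: (@squeeze_cvgr _ _ _ _ (cst (phi s)) (fun n => phi s + geometric (phi r - phi l) 2^-1 n)).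
- apply: nearW => n; have [h1 h2 h3] := inI n.
  have e1 : phi s <= phi (p n).2 by apply: phi_nd.
  have e2 : phi (p n).1 <= phi s by apply: phi_nd.
  apply/andP; split => //.
  by have := gap n; rewrite -lerBlDl; apply: le_trans; rewrite lerB.
- exact: cvg_cst.
- rewrite -[X in _ --> X]addr0; apply: cvgD; first exact: cvg_cst.
  by apply: cvg_geometric; rewrite ger0_norm; lra.
Qed.

(** * Blocks between consecutive terms of a decreasing sequence *)

Section descending_blocks.
Context {R : realType} (I : set R) (s : R) (b w : R^nat).
Hypotheses (mI : measurable I) (I0 : I `<=` [set t | 0 <= t]).
Hypotheses (s0 : 0 < s) (sb : forall n, s < b n).
Hypotheses (bS : forall n, b n.+1 < b n) (bI : `[0, b 0%N] `<=` I).
Hypothesis w0 : forall n, 0 <= w n.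

Let J n : set R := `[b n.+1, b n[%classic.
(** The factor $k_n$ normalizes the $n$-th block so that $f_n(t)/t$ has
    integral $w_n$. *)
Let k n : R := w n / (b n - b n.+1).

Let k0 n : 0 <= k n.
Proof. by rewrite divr_ge0// subr_ge0 ltW. Qed.

Let mJ n : measurable (J n).
Proof. exact: measurable_itv. Qed.

Let b_ni : nonincreasing_seq b.
Proof. by apply/nonincreasing_seqP => n; exact: ltW. Qed.

Let tJ : trivIset setT J.
Proof.
have lt_absurd m n t : (m < n)%N -> J m t -> J n t -> False.
  move=> mn; rewrite /J/= !in_itv/= => /andP[h _] /andP[_ h'].
  by have := le_lt_trans (le_trans (b_ni _ _ mn) h) h'; rewrite ltxx.
move=> m n _ _ [t [Jm Jn]]; have [mn|nm|//] := ltngtP m n.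
- by case: (lt_absurd _ _ _ mn Jm Jn).
- by case: (lt_absurd _ _ _ nm Jn Jm).
Qed.

Let J0 n t : J n t -> 0 < t.
Proof.
rewrite /J/= in_itv/= => /andP[h _].
exact: lt_le_trans (lt_trans s0 (sb _)) h.
Qed.

Let JI n : J n `<=` I.
Proof.
move=> t Jt; apply: bI; rewrite /= in_itv/= (ltW (J0 _ _ Jt))/=.
move: Jt; rewrite /J/= in_itv/= => /andP[_ /ltW h].
exact: le_trans h (b_ni _ _ (leq0n n)).
Qed.

Let muJ n : mu R (J n) = (b n - b n.+1)%:E.
Proof. by rewrite completed_lebesgue_measure_itv/= lte_fin bS. Qed.

Let mJx n x : measurable (J n `&` (I `&` `[x, +oo[) : set (lebesgue_type R)).
Proof.
by apply: borel_lebesgue_measurable; do 2 apply: measurableI => //.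
Qed.

Let kJ n : ((k n)%:E * mu R (J n) = (w n)%:E)%E.
Proof.
by rewrite muJ -EFinM /k divfK// subr_eq0 gt_eqF.
Qed.

(** The next three facts locate $C^*f_n(x)=k_n\,|J_n\cap[x,\infty)|$: it is
    at most $w_n$, equal to $w_n$ left of the block and $0$ right of it. *)
Let mass_le n x : ((k n)%:E * mu R (J n `&` (I `&` `[x, +oo[)) <= (w n)%:E)%E.
Proof.
rewrite -(kJ n); apply: lee_wpmul2l; first by rewrite lee_fin.
by apply: le_measure; rewrite ?inE//; exact: borel_lebesgue_measurable.
Qed.

Let mass_full n x : x <= b n.+1 ->
  ((k n)%:E * mu R (J n `&` (I `&` `[x, +oo[)) = (w n)%:E)%E.
Proof.
move=> xb; rewrite -[RHS](kJ n); congr (_ * mu R _)%E.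
apply/seteqP; split => [t []//|t Jt]; split => //; split; first exact: JI Jt.
by move: Jt; rewrite /J/= !in_itv/= andbT => /andP[h _]; exact: le_trans h.
Qed.

Let mass_empty n x : b n < x ->
  ((k n)%:E * mu R (J n `&` (I `&` `[x, +oo[)) = 0)%E.
Proof.
move=> bx; rewrite (_ : _ `&` _ = set0) ?measure0 ?mule0//.
apply/seteqP; split => // t [+ [_]]; rewrite /J/= !in_itv/= andbT.
by move=> /andP[_ tb] xt; have := lt_trans (le_lt_trans xt tb) bx; rewrite ltxx.
Qed.

Definition descending_block (n : nat) : R -> R := block k J n.

Definition descending_blocksum (alpha : R^nat) : R -> R := blocksum k J alpha.

Lemma cvg_descending_blocksum (alpha : R^nat) (t : R) :
  series (fun n => alpha n * descending_block n t) @ \oo -->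
  descending_blocksum alpha t.
Proof. exact: cvg_blocksum. Qed.

Lemma L0_descending_blocksum (alpha : R^nat) :
  L0 I (descending_blocksum alpha).
Proof. exact: L0_blocksum. Qed.

Lemma disjoint_supports_descending_block (m n : nat) : m <> n ->
  disjoint_supports I (descending_block m) (descending_block n).
Proof.
move=> mn; apply: ae_onW => t _.
have [p p0] := @trivIset_indic_single R J tJ t.
have [pm|/eqP pm] := eqVneq m p.
  by right; rewrite /descending_block /block p0 ?mulr0// -pm => /esym.
by left; rewrite /descending_block /block p0 ?mulr0.
Qed.

Variable alpha : R^nat.
Hypothesis cw : cvgn (series (fun n => `|alpha n| * w n)).

Let aw0 n : 0 <= `|alpha n| * w n. Proof. by rewrite mulr_ge0. Qed.

Let copsonE x : (copson I (fun t => `|descending_blocksum alpha t|%R) x =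
  \sum_(n <oo) `|alpha n|%:E * ((k n)%:E * mu R (J n `&` (I `&` `[x, +oo[))))%E.
Proof.
rewrite /descending_blocksum (copson_blocksum I k J mI k0 mJ tJ J0 alpha x).
by apply: eq_eseriesr => n _; rewrite EFinM muleA.
Qed.

Let mass_ge0 n x :
  (0 <= `|alpha n|%:E * ((k n)%:E * mu R (J n `&` (I `&` `[x, +oo[))))%E.
Proof. by rewrite !mule_ge0// lee_fin. Qed.

Let scale_le n (y z : \bar R) :
  (y <= z -> `|alpha n|%:E * y <= `|alpha n|%:E * z)%E.
Proof. by move=> yz; rewrite lee_wpmul2l// lee_fin. Qed.

Let is_cvg_ind x : cvgn (series (fun n => `|alpha n| * (w n * \1_(`[0, b n]) x))).
Proof.
apply: (series_le_cvg _ _ _ cw) => n; rewrite ?mulr_ge0//.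
by rewrite ler_wpM2l// ler_piMr// indicE lern1 leq_b1.
Qed.

Lemma copson_descending_blocksum_le_indic x : 0 <= x ->
  (copson I (fun t => `|descending_blocksum alpha t|%R) x <=
   (limn (series (fun n => `|alpha n| * (w n * \1_(`[0, b n]) x))))%:E)%E.
Proof.
move=> x0; rewrite copsonE -(EFin_lim_series _ (is_cvg_ind x)).
apply: lee_nneseries => [n _ _|n _]; first exact: mass_ge0.
rewrite [leRHS]EFinM; apply: scale_le.
have [xb|bx] := leP x (b n); last by rewrite mass_empty// lee_fin mulr_ge0.
by rewrite indicE mem_set ?mulr1//= in_itv/= x0.
Qed.

Lemma copson_descending_blocksum_le x :
  (copson I (fun t => `|descending_blocksum alpha t|%R) x <=
   (limn (series (fun n => `|alpha n| * w n)))%:E)%E.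
Proof.
rewrite copsonE -(EFin_lim_series _ cw).
apply: lee_nneseries => [n _ _|n _]; first exact: mass_ge0.
by rewrite [leRHS]EFinM; exact: scale_le.
Qed.

(** Left of $s$, hence of all the blocks, every block contributes its full
    mass: this is the source of the lower $\ell^1$ estimate. *)
Lemma copson_descending_blocksum_low x : x <= s ->
  copson I (fun t => `|descending_blocksum alpha t|%R) x =
   (limn (series (fun n => `|alpha n| * w n)))%:E.
Proof.
move=> xs; rewrite copsonE -(EFin_lim_series _ cw).
apply: eq_eseriesr => n _.
by rewrite [RHS]EFinM mass_full// (le_trans xs)// ltW.
Qed.

Lemma copson_descending_blocksum_fin x :
  copson I (fun t => `|descending_blocksum alpha t|%R) x \is a fin_num.
Proof.
rewrite ge0_fin_numE; last exact: copson_ge0.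
exact: le_lt_trans (copson_descending_blocksum_le x) (ltry _).
Qed.

(** A nonincreasing finite function is measurable. *)
Lemma L0_copson_descending_blocksum :
  L0 I (copson_abs I (descending_blocksum alpha)).
Proof.
apply: borel_measurable_fun_lebesgue => //.
apply: nonincreasing_measurable => // x y xy.
apply: fine_le; try exact: copson_descending_blocksum_fin.
rewrite !copsonE; apply: lee_nneseries => [n _ _|n _]; first exact: mass_ge0.
apply: scale_le; apply: lee_wpmul2l; first by rewrite lee_fin.
apply: le_measure; rewrite ?inE//.
apply: setIS; apply: setIS => t; rewrite /= !in_itv/= !andbT; exact: le_trans.
Qed.

End descending_blocks.

(** * Asymptotically isometric copies of $\ell^1$ *)

(** Expresses a partial sum minus the full sum as a series again, so that
    bounds valid for all coefficient sequences apply to remainders. *)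
Lemma cvg_series_tail {R : realType} (a : R^nat) (l : R) (N : nat) :
  series a @ \oo --> l ->
  series (fun n => if (n < N)%N then 0 else - a n) @ \oo --> series a N - l.
Proof.
move=> al.
have : series a N - series a M @[M --> \oo] --> series a N - l.
  by apply: cvgB => //; exact: cvg_cst.
apply: cvg_trans; apply: near_eq_cvg; near=> M.
have NM : (N <= M)%N by near: M; exists N.
rewrite /series/= !(big_cat_nat (leq0n N) NM)/= opprD addrA subrr sub0r.
rewrite [X in _ = X + _](_ : _ = 0) ?add0r; last first.
  by rewrite big_nat big1// => n /andP[_ ->].
rewrite -sumrN; apply: eq_big_nat => n /andP[Nn _]; rewrite ltnNge Nn//.
Unshelve. all: by end_near. Qed.

Lemma L0_indic {R : realType} (I A : set R) :
  measurable I -> measurable A -> L0 I (\1_A).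
Proof.
by move=> mI mA; apply: borel_measurable_fun_lebesgue => //; exact: measurable_indic.
Qed.

(** Since $f\neq0$, some $c=C^*|f|(r)$ with $r>0$ is positive, and it is finite
    because $C^*|f|$ is nonincreasing and finite at some point of $(0,r]$.
    Monotonicity then gives $c\chi_{[0,r]}\le C^*|f|$. *)
Lemma copson_space_nontrivial_indic {R : realType} (I : set R) (X : function_space R) :
  measurable I -> I `<=` [set t | 0 <= t] ->
  (forall x y, I x -> 0 <= y <= x -> I y) ->
  linear_subspace I X -> ideal_property I X ->
  nontrivial I (copson_space I X) ->
  exists r : R, [/\ 0 < r, `[0, r] `<=` I & X (\1_`[0, r])].
Proof.
move=> mI I0 Icl [_ _ _ XZ] iX [f [L0f ffin Xf] fn0].
pose C x := copson I (fun t => `|f t|) x.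
have [n Cn] : exists n : nat, C n.+1%:R^-1 <> 0%E.
  apply/existsNP => C0; apply: fn0; exact: copson_eq0_ae.
pose r : R := n.+1%:R^-1.
have r0 : 0 < r by rewrite invr_gt0.
have [t It rt] : exists2 t, I t & r <= t.
  apply: contrapT => nt; apply: Cn; rewrite /C /copson.
  rewrite (_ : _ `&` _ = set0) ?integral_set0//.
  apply/seteqP; split => // t [It]; rewrite /= in_itv/= andbT => rt.
  by apply: nt; exists t.
have rI : `[0, r] `<=` I.
  move=> y; rewrite /= in_itv/= => /andP[y0 yr].
  by apply: (Icl t) => //; rewrite y0 (le_trans yr).
have C0 x : (0 <= C x)%E by exact: copson_ge0.
have Cni x : 0 < x -> x <= r -> (C r <= C x)%E by move=> *; exact: copson_nincr.
have pos_fin : ae_on I (fun x => 0 < x /\ C x \is a fin_num).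
  have FF := ae_filter R; apply: filterS2 (ae_neq0 R) ffin => x x0 Cx Ix.
  split; last exact: Cx.
  by rewrite lt_neqAle eq_sym; apply/andP; split; [exact/eqP|exact: I0].
have Crfin : C r \is a fin_num.
  have [x /andP[x0 xr] [xp Cx]] := ae_on_itv0_ex _ _ _ r0 rI pos_fin.
  rewrite ge0_fin_numE//; apply: le_lt_trans (Cni x xp xr) _.
  by rewrite -ge0_fin_numE.
have c0 : 0 < fine (C r).
  by rewrite fine_gt0// ltey_eq Crfin andbT lt0e C0 andbT; apply/eqP.
exists r; split => //.
apply: (iX _ _ (L0_indic _ _ mI (measurable_itv _)) (XZ (fine (C r))^-1 _ Xf) _).1.
apply: ae_onS pos_fin => x Ix [x0 Cx]; rewrite indicE.
have [xr|] := boolP (x \in _); last by rewrite normr0.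
move: xr; rewrite inE/= in_itv/= => /andP[_ xr].
rewrite normr1 normrM ger0_norm ?invr_ge0 ?(ltW c0)// ger0_norm ?fine_ge0//.
by rewrite ler_pdivlMl// mulr1 fine_le// Cni.
Qed.

Theorem theorem4p6 (R : realType) (I : set R)
    (hI : I = `[0, 1]%classic \/ I = `[0, +oo[%classic)
    (X : function_space R) (hX : banach_function_space I X)
    (hnt : nontrivial I (copson_space I X)) :
  order_asymptotically_isometric_l1_copy I (copson_space I X).
Proof.
have mI : measurable I by case: hI => ->; exact: measurable_itv.
have I0 : I `<=` [set t | 0 <= t].
  by case: hI => -> t; rewrite /= in_itv/= => /andP[].
have Icl x y : I x -> 0 <= y <= x -> I y.
  case: hI => ->; rewrite /= !in_itv/= => /andP[_ x1] /andP[-> yx]//.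
  exact: le_trans x1.
have [lX nX _ iX _] := hX; have [_ _ _ XZ] := lX; have [n0 neq0 nZ _] := nX.
have [r [r0 rI Xr]] := copson_space_nontrivial_indic _ _ mI I0 Icl lX iX hnt.
pose chi (x : R) : R -> R := \1_`[0, x].
pose phi x := fnorm X (chi x).
have chi_le x y t : x <= y -> chi x t <= chi y t.
  move=> xy; rewrite /chi !indicE ler_nat.
  have [tx|tx] := boolP (t \in _); last by [].
  rewrite mem_set//; move: tx; rewrite inE/= !in_itv/= => /andP[-> tx].
  exact: le_trans xy.
have chi_ge0 x t : 0 <= chi x t by rewrite /chi indicE.
have L0chi x : L0 I (chi x) by apply: L0_indic => //; exact: measurable_itv.
have chi_dom x y : x <= y -> X (chi y) -> X (chi x) /\ phi x <= phi y.
  move=> xy Xy; apply: iX => //; apply: ae_onW => t _.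
  by rewrite !ger0_norm// chi_le.
have Xchi x : x <= r -> X (chi x) by move=> xr; have [] := chi_dom _ _ xr Xr.
have phi_gt0 x : 0 < x -> x <= r -> 0 < phi x.
  move=> x0 xr; rewrite lt_neqAle n0 ?andbT; last exact: Xchi.
  apply/eqP => /esym/(neq0 _ (Xchi _ xr)) chi0.
  have xI : `[0, x] `<=` I.
    by apply: subset_trans rI => t; rewrite /= !in_itv/= => /andP[-> /le_trans ->].
  have [t tx] := ae_on_itv0_ex _ _ _ x0 xI chi0.
  by rewrite /chi indicE mem_set/= ?in_itv//= => /eqP; rewrite oner_eq0.
(* Starting from r / 2 rather than 0 keeps s, and with it phi s, positive. *)
have [||s [b [ls sb bS br phib]]] :=
  @nondecreasing_right_continuity_point R phi (r / 2) r.
- by rewrite ltr_pdivrMr// ltr_pMr// ltr1n.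
- move=> x y _; rewrite in_itv/= => /andP[_ yr] xy.
  by have [] := chi_dom _ _ xy (Xchi _ yr).
have s0 : 0 < s by apply: lt_trans ls; rewrite divr_gt0.
have b_ni : nonincreasing_seq b by apply/nonincreasing_seqP => n; exact: ltW.
have brn n : b n <= r by apply: le_trans br; exact: b_ni.
have b0 n : 0 < b n by exact: lt_trans (sb n).
have phis : 0 < phi s by apply: phi_gt0 => //; exact: le_trans (ltW (sb 0%N)) br.
have phibn n : 0 < phi (b n) by exact: phi_gt0.
have phi_sb n : phi s <= phi (b n).
  by have [] := chi_dom _ _ (ltW (sb n)) (Xchi _ (brn n)).
pose w n := (phi (b n))^-1.
have w0 n : 0 <= w n by rewrite invr_ge0 ltW.
have ws n : w n <= (phi s)^-1 by rewrite lef_pV2 ?posrE.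
have bI : `[0, b 0%N] `<=` I.
  by apply: subset_trans rI => t; rewrite /= !in_itv/= => /andP[-> /le_trans ->].
pose G := descending_blocksum b w.
pose f := descending_block b w.
have cw (alpha : R^nat) : cvgn (series (fun n => `|alpha n|)) ->
    cvgn (series (fun n => `|alpha n| * w n)).
  move=> ca; apply: (@series_le_cvg _ _ (fun n => `|alpha n| * (phi s)^-1)).
  - by move=> n; rewrite mulr_ge0.
  - by move=> n; rewrite mulr_ge0// invr_ge0 ltW.
  - by move=> n; rewrite ler_wpM2l.
  - rewrite (_ : (fun n => _) = (phi s)^-1 *: (fun n => `|alpha n|)).
      exact: is_cvg_seriesZ.
    by apply/funext => n /=; rewrite mulrC.
(* Used for the given coefficients, for unit vectors and for tails. *)
have upper (alpha : R^nat) : cvgn (series (fun n => `|alpha n|)) ->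
    X (copson_abs I (G alpha)) /\
    fnorm X (copson_abs I (G alpha)) <= limn (series (fun n => `|alpha n|)).
  move=> ca.
  apply: (@fnorm_series_le R I X (fun n t => w n * chi (b n) t)
    (fun t => (phi s)^-1 * chi (b 0%N) t)) => //.
  - by move=> n; apply: XZ; exact: Xchi.
  - move=> n; rewrite nZ; last exact: Xchi.
    by rewrite ger0_norm// mulVf// gt_eqF.
  - by apply: XZ; exact: Xchi.
  - move=> n t It; rewrite mulr_ge0//=; apply: ler_pM => //.
    by apply: chi_le; exact: b_ni.
  - by apply: (@L0_copson_descending_blocksum R I s) => //; exact: cw.
  - move=> t It; have t0 : 0 <= t by exact: I0.
    rewrite /copson_abs ger0_norm ?fine_ge0 ?copson_ge0//.
    rewrite -lee_fin fineK.
      by apply: (@copson_descending_blocksum_le_indic R I s) => //; exact: cw.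
    by apply: (@copson_descending_blocksum_fin R I s) => //; exact: cw.
have inE_ (alpha : R^nat) : cvgn (series (fun n => `|alpha n|)) ->
    copson_space I X (G alpha).
  move=> ca; split; last exact: (upper _ ca).1.
    exact: L0_descending_blocksum.
  apply: ae_onW => t It.
  by apply: (@copson_descending_blocksum_fin R I s) => //; exact: cw.
have lower (alpha : R^nat) : cvgn (series (fun n => `|alpha n|)) ->
    phi s * limn (series (fun n => `|alpha n| * w n)) <=
    fnorm X (copson_abs I (G alpha)).
  move=> ca.
  set c := limn _.
  have c0 : 0 <= c.
    apply: limr_ge; first exact: cw.
    by apply: nearW => n; apply: sumr_ge0 => i _; rewrite mulr_ge0.
  have sr : s <= r by apply: le_trans (brn 0%N); exact: ltW.
  have -> : phi s * c = fnorm X (fun t => c * chi s t).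
    by rewrite nZ ?(ger0_norm c0) 1?mulrC//; exact: Xchi.
  apply: (iX _ _ _ (upper _ ca).1 _).2.
    apply: borel_measurable_fun_lebesgue => //.
    apply: measurable_funM; first exact: measurable_cst.
    by apply: measurable_indic; exact: measurable_itv.
  apply: ae_onW => t It; have t0 : 0 <= t by exact: I0.
  rewrite /copson_abs [leRHS]ger0_norm ?fine_ge0 ?copson_ge0//.
  rewrite ger0_norm ?mulr_ge0//; have [ts|st] := leP t s.
    rewrite (@copson_descending_blocksum_low R I s)//; last exact: cw.
    by rewrite /= /chi indicE ler_piMr// lern1 leq_b1.
  rewrite /chi indicE memNset ?mulr0 ?fine_ge0 ?copson_ge0//=.
  by rewrite in_itv/= (lt_geF st) andbF.
have GE (alpha : R^nat) t : series (fun n => alpha n * f n t) @ \oo --> G alpha t.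
  exact: cvg_descending_blocksum.
(* The factor 1 - 1/(n+2) keeps eps n positive even if phi (b n) = phi s. *)
pose eps n : R := 1 - phi s * w n * (1 - n.+2%:R^-1).
have epsE n : 1 - eps n = phi s * w n * (1 - n.+2%:R^-1) by rewrite /eps subKr.
have n2 n : 0 < 1 - n.+2%:R^-1 :> R by rewrite subr_gt0 invf_lt1// ltr1n.
have n2' n : 1 - n.+2%:R^-1 < 1 :> R by rewrite ltrBlDr ltrDl invr_gt0.
have wgt0 n : 0 < w n by rewrite invr_gt0.
have sw1 n : phi s * w n <= 1 by rewrite ler_pdivrMr// mul1r.
exists f, eps; split.
- move=> n; pose delta (m : nat) : R := (m == n)%:R.
  have cd : series (fun m => `|delta m|) @ \oo --> `|delta n|.
    apply: (@cvg_series_single R (fun m => `|delta m|)) => m /eqP/negbTE mn.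
    by rewrite /delta mn normr0.
  have -> : f n = G delta.
    apply/funext => t; rewrite -(cvg_lim _ (GE delta t))//.
    have dt : series (fun m => delta m * f m t) @ \oo --> delta n * f n t.
      apply: (@cvg_series_single R (fun m => delta m * f m t)) => m /eqP/negbTE mn.
      by rewrite /delta mn mul0r.
    by rewrite (cvg_lim _ dt)// /delta eqxx mul1r.
  by apply: inE_; apply/cvg_ex; eexists; exact: cd.
- by move=> m n mn; exact: disjoint_supports_descending_block.
- move=> n; rewrite -(subKr 1 (eps n)) epsE subr_gt0 ltrBlDr ltrDl.
  rewrite !mulr_gt0// andbT.
  by apply: le_lt_trans (n2' n); rewrite ler_piMl// ltW.
- have -> : 0 = 1 - phi s * (phi s)^-1 * (1 - 0) :> R.
    by rewrite divff ?gt_eqF// subr0 mulr1 subrr.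
  apply: cvgB; first exact: cvg_cst.
  apply: cvgM; first by apply: cvgMr; apply: cvgV => //; rewrite gt_eqF.
  apply: cvgB; first exact: cvg_cst.
  by have := @cvg_harmonic R; rewrite -cvg_shiftS.
move=> alpha ca; exists (G alpha); split.
- exact: inE_.
- have tailE N : (fun x => \sum_(0 <= n < N) alpha n * f n x) \- G alpha =
      G (fun n => if (n < N)%N then 0 else - alpha n).
    apply/funext => t; rewrite -[RHS](cvg_lim _ (GE _ t))//; apply/esym/cvg_lim => //.
    have := @cvg_series_tail R _ _ N (GE alpha t).
    rewrite (_ : (fun n => if _ then _ else - (alpha n * f n t)) =
      (fun n => (if (n < N)%N then 0 else - alpha n) * f n t))//.
    by apply/funext => n; case: ifP => _; rewrite ?mul0r ?mulNr.
  have cN : series (fun n => - `|alpha n|) @ \oo -->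
      - limn (series (fun n => `|alpha n|)).
    rewrite (_ : (fun n => _) = - (fun n => `|alpha n|)) ?seriesN//.
    exact: cvgN.
  have ctail N := @cvg_series_tail R _ _ N cN.
  have abs_tail N : (fun n => `|if (n < N)%N then 0 else - alpha n|) =
      (fun n => if (n < N)%N then 0 else - - `|alpha n|).
    by apply/funext => n; case: ifP => _; rewrite ?normr0// normrN opprK.
  rewrite /norm_cvg.
  apply: (@squeeze_cvgr _ _ _ _ (cst 0) (fun N =>
    limn (series (fun n => `|alpha n|)) - series (fun n => `|alpha n|) N)).
  + apply: nearW => N; rewrite tailE.
    have ct : cvgn (series (fun n => `|if (n < N)%N then 0 else - alpha n|)).
      by rewrite abs_tail; apply/cvg_ex; eexists; exact: ctail.
    have [Xt nt] := upper _ ct; rewrite /= n0//=.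
    apply: le_trans nt _; rewrite abs_tail (cvg_lim _ (ctail N))// opprK addrC.
    by rewrite lerD2l /series/= sumrN.
  + exact: cvg_cst.
  + rewrite -(subrr (limn (series (fun n => `|alpha n|)))).
    by apply: cvgB => //; exact: cvg_cst.
- apply: le_trans (lower _ ca).
  rewrite -[leRHS]/(phi s *: limn (series (fun n => `|alpha n| * w n))).
  rewrite -lim_seriesZ; last exact: cw.
  have eps_le n : (1 - eps n) * `|alpha n| <= phi s * (`|alpha n| * w n).
    rewrite epsE [leRHS]mulrCA mulrC ler_wpM2l// ler_piMr ?mulr_ge0// ltW//.
  apply: lim_series_le => //; last by apply: is_cvg_seriesZ; exact: cw.
  apply: (@series_le_cvg _ _ (phi s *: (fun n => `|alpha n| * w n))) => //.
  + by move=> n; rewrite epsE !mulr_ge0// ltW.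
  + by move=> n; rewrite !mulr_ge0// ltW.
  + by apply: is_cvg_seriesZ; exact: cw.
- exact: (upper _ ca).2.
Qed.
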